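(* Let $m\ge n\ge 0$ be integers, $d:=m-n$, and let $\alpha\in\mathbb{C}$ with $\Re\alpha>-1$. Then $$\int_0^1\!\!\int_0^x (x-y)^{\alpha}\,p_m(x)\,p_n(y)\,dy\,dx \;=\;\frac{(-1)^d}{\alpha+1}\;\frac{\left(\frac{d-\alpha}{2}\right)_{n}\,(-\alpha-1)_{d}}{\left(\frac{\alpha+d+4}{2}\right)_{n}\,(\alpha+2)_{d+1}} .$$
   Context: $P_n$ denotes the Legendre polynomial of degree $n$ (orthogonal on $[-1,1]$, normalized by $P_n(1)=1$), and $p_n(x)=P_n(2x-1)$ is the shifted Legendre polynomial on $[0,1]$. For $a\in\mathbb{C}$ and an integer $k\ge0$, $(a)_k=a(a+1)\cdots(a+k-1)$ with $(a)_0=1$. *)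

(* Defs.v *)
From HB Require Import structures.
From mathcomp Require Import all_boot all_order all_algebra.
From mathcomp Require Import all_classical all_reals all_analysis.
From mathcomp.real_closed Require Import complex.
Set Implicit Arguments.
Unset Strict Implicit.
Unset Printing Implicit Defensive.
Import Order.TTheory GRing.Theory Num.Theory.
Local Open Scope classical_set_scope.
Local Open Scope ring_scope.
Local Open Scope complex_scope.

(* These conditions determine the whole family [P]: pairwise orthogonality
   together with [deg P_n = n] makes [P_n] orthogonal to every polynomial of
   smaller degree, and the value at 1 fixes the scaling. *)
Definition is_legendre (R : realType) (P : nat -> {poly R}) : Prop :=
  [/\ forall n, size (P n) = n.+1,
      forall m n, m != n ->
        \int[@lebesgue_measure R]_(x in `[-1, 1]) ((P m).[x] * (P n).[x]) = 0
    & forall n, (P n).[1] = 1].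

Definition shifted (R : realType) (P : nat -> {poly R}) (n : nat) : {poly R} :=
  P n \Po (2%:P * 'X - 1).

Definition pochhammer (K : pzRingType) (a : K) (k : nat) : K :=
  \prod_(i < k) (a + i%:R).

(* [t ^ a = exp (a * ln t)] for [t > 0], written in polar form; the value at
   [t = 0] is a convention. *)
Definition cpow (R : realType) (t : R) (a : R[i]) : R[i] :=
  (t `^ complex.Re a)%:C *
  (cos (complex.Im a * ln t) +i* sin (complex.Im a * ln t)).

Definition cintegrable (R : realType) (D : set R) (f : R -> R[i]) : Prop :=
  (@lebesgue_measure R).-integrable D (EFin \o (fun x => complex.Re (f x))) /\
  (@lebesgue_measure R).-integrable D (EFin \o (fun x => complex.Im (f x))).

Definition cintegral (R : realType) (D : set R) (f : R -> R[i]) : R[i] :=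
  (\int[@lebesgue_measure R]_(x in D) complex.Re (f x)) +i*
  (\int[@lebesgue_measure R]_(x in D) complex.Im (f x)).

(* Main.v *)
Require Import Defs.
From HB Require Import structures.
From mathcomp Require Import all_boot all_order all_algebra.
From mathcomp Require Import all_classical all_reals all_analysis.
From mathcomp.real_closed Require Import complex.
From mathcomp Require Import measurable_realfun ring lra.
Set Implicit Arguments.
Unset Strict Implicit.
Unset Printing Implicit Defensive.
Import Order.TTheory GRing.Theory Num.Theory.
Import numFieldNormedType.Exports.
Local Open Scope classical_set_scope.
Local Open Scope ring_scope.
Local Open Scope complex_scope.

(** The integral is turned into a rational function of [alpha], and that
    function is evaluated by a recurrence on the two degrees.

    Reduction to algebra. For [j : nat] the Beta integral gives
    [int_0^x (x - y)^a y^j dy = j! / (a + 1)_(j+1) * x^(a + j + 1)], proved by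
    induction on [j] from [y = x - (x - y)] ([has_cint_beta]); the base case is
    the fundamental theorem of calculus for an integrand with an integrable
    singularity ([ge0_FTC2_oo], [dominated_FTC2]). Integrating in [x] shows
    that for polynomials [f] and [g] the double integral of
    [(x - y)^a f(x) g(y)] is
    [B(f, g) = sum_j g_j * j! / (a + 1)_(j+1) * M_(a+j+1)(f)], where
    [M_s(f) = sum_i f_i / (s + i + 1)] is the formal value of
    [int_0^1 x^s f(x) dx] ([has_cint_outer]).

    Integration by parts. Since [(x - y)^a] is killed by [d/dx + d/dy],
    [B(f', g) = - B(f, g')] as soon as [f(1) = 0] and [g(0) = 0]
    ([bform_parts]). On Legendre polynomials this applies to
    [q_k = p_(k+1) - p_(k-1)], which vanishes at both endpoints and satisfies
    [q_k' = 2 (2k + 1) p_k] ([deriv_shiftedB]), and it yields, with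
    [I(m, n) = B(p_m, p_n)] and [m, n >= 1],
    [(2m+1) (I(m, n+1) - I(m, n-1)) + (2n+1) (I(m+1, n) - I(m-1, n)) = 0]
    ([bform_recurrence]). This determines all [I(m, n)] with [n <= m] from the
    columns [n = 0] and [n = 1], and the closed form obeys the same relation
    ([closed_form_recurrence]).

    Legendre polynomials. Everything needed about [p_m] follows from
    orthogonality to smaller degrees, [p_m(1) = 1] and one remark: multiplied
    by its denominators, [M_s(p_m)] is a polynomial in [s] of degree at most
    [m] whose roots [0, ..., m - 1] are known, so it is
    [p_m(1) * s (s - 1) ... (s - m + 1)] ([moment_numerator_factor]). Its value
    gives the first two columns ([moment_closed_form]) and its residues give
    the coefficients of [p_m] ([legendre_coefP]). *)

(** * The fundamental theorem of calculus for singular integrands *)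

(** The antiderivative only has to be continuous at the endpoints, where [f]
    itself may blow up: for [f >= 0] the integrals over an exhausting sequence
    of compact subintervals converge monotonically. *)
Lemma ge0_FTC2_oo (R : realType) (f F : R -> R) (a b : R) : a < b ->
  (forall x, a < x < b -> 0 <= f x) ->
  (forall x, a < x < b -> is_derive x 1 F (f x)) ->
  (forall x, a < x < b -> {for x, continuous f}) ->
  F x @[x --> a^'+] --> F a -> F x @[x --> b^'-] --> F b ->
  (\int[@lebesgue_measure R]_(x in `]a, b[) (f x)%:E = (F b - F a)%:E)%E.
Proof.
move=> ab f0 dF cf Fa Fb.
(* [n + 3] makes [a + e n < b - e n] hold for every [n]. *)
pose e n : R := (b - a) / n.+3%:R.
have ba0 : 0 < b - a by rewrite subr_gt0.
have e0 n : 0 < e n by rewrite divr_gt0.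
have e_small n : e n + e n < b - a.
  rewrite -mulrDr gtr_pMr// -mulr2n -(mulr_natl _ 2) ltr_pdivrMr// mul1r.
  by rewrite ltr_nat.
have e_cvg : e n @[n --> \oo] --> 0.
  rewrite -(mulr0 (b - a)); apply: cvgM; first exact: cvg_cst.
  have := @cvg_harmonic R; rewrite -(cvg_shiftn 2).
  by under eq_fun do rewrite /= addn2.
have e_noninc m n : (m <= n)%N -> e n <= e m.
  by move=> mn; rewrite ler_pM2l// lef_pV2 ?posrE// ler_nat.
pose I n : set R := `[a + e n, b - e n]%classic.
have Iab n x : I n x -> a < x < b.
  rewrite /I /= in_itv/= => /andP[h1 h2].
  rewrite (lt_le_trans _ h1) ?ltrDl//=.
  by rewrite (le_lt_trans h2)// ltrBlDr ltrDl.
have IU : \bigcup_n I n = `]a, b[%classic.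
  apply/seteqP; split=> [x [n _ /Iab]|x /=]; first by rewrite /= in_itv.
  rewrite in_itv/= => /andP[ax xb].
  have h1 : \forall n \near \oo, e n < x - a.
    by move/cvgr_lt: e_cvg; apply; rewrite subr_gt0.
  have h2 : \forall n \near \oo, e n < b - x.
    by move/cvgr_lt: e_cvg; apply; rewrite subr_gt0.
  near \oo => n.
  exists n => //; rewrite /I /= in_itv/=; apply/andP; split.
    by rewrite addrC -lerBrDr ltW//; near: n.
  by rewrite lerBrDr -lerBrDl ltW//; near: n.
have ndI : nondecreasing_seq I.
  move=> m n mn; rewrite subsetEset => x; rewrite /I /= !in_itv/= => /andP[h1 h2].
  rewrite (le_trans _ h1) ?lerD2l ?e_noninc//=.
  by rewrite (le_trans h2)// lerD2l lerN2 e_noninc.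
have mf n : measurable_fun (I n) f.
  apply: (@measurable_funS _ _ _ _ `]a, b[%classic) => //.
    by move=> x /Iab; rewrite /= in_itv.
  apply: open_continuous_measurable_fun => // x.
  by rewrite inE/= in_itv/= => /cf.
have h : (\int[@lebesgue_measure R]_(x in I i) (f x)%:E @[i --> \oo] -->
    \int[@lebesgue_measure R]_(x in \bigcup_i I i) (f x)%:E)%E.
  apply: ge0_nondecreasing_set_cvg_integral => //.
  - by move=> n; rewrite /I; exact: measurable_itv.
  - by move=> n; apply/measurable_EFinP; exact: mf.
  - by move=> n x /Iab xab; rewrite lee_fin f0.
rewrite IU in h.
have eqI n : (\int[@lebesgue_measure R]_(x in I n) (f x)%:E)%E =
    (F (b - e n) - F (a + e n))%:E.
  rewrite /I.
  have lt_e : a + e n < b - e n by have := e_small n; lra.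
  rewrite (@continuous_FTC2 _ f F)//.
  - apply: continuous_in_subspaceT => x; rewrite inE => /Iab.
    exact: cf.
  - have Fd x : I n x -> derivable F x 1.
      by move=> /Iab /dF h'; exact: ex_derive.
    have Fc x : I n x -> {for x, continuous F}.
      by move=> /Fd h'; apply/differentiable_continuous/derivable1_diffP.
    split.
    + move=> x xI; apply: Fd; move: xI; rewrite /I/= !in_itv/= => /andP[? ?].
      by rewrite !ltW.
    + by apply: cvg_at_right_filter; apply: Fc; rewrite /I/= in_itv/= lexx ltW.
    + by apply: cvg_at_left_filter; apply: Fc; rewrite /I/= in_itv/= lexx ltW.
  - move=> x xI; rewrite derive1E.
    have /dF : a < x < b.
      apply: (Iab n); move: xI; rewrite /I/= !in_itv/= => /andP[? ?].
      by rewrite !ltW.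
    by move=> h'; rewrite derive_val.
apply: (cvg_unique _ h) => //.
rewrite (_ : (fun _ => _) = EFin \o (fun n => F (b - e n) - F (a + e n))).
  2: by apply/funext => n /=; rewrite -eqI.
apply: cvg_EFin; first exact: nearW.
apply: cvgB.
  move/cvg_at_leftP : Fb; apply; split.
    by move=> n; rewrite ltrBlDr ltrDl.
  rewrite -[X in _ --> X](subr0 b).
  by apply: cvgB => //; exact: cvg_cst.
move/cvg_at_rightP : Fa; apply; split.
  by move=> n; rewrite ltrDl.
rewrite -[X in _ --> X](addr0 a).
by apply: cvgD => //; exact: cvg_cst.
Unshelve. all: by end_near. Qed.

(** Both [g] and [f + g] are nonnegative, so the previous lemma integrates them,
    and [f] is their difference; the antiderivative [G] of the bound [g] is what
    gives integrability of [f]. *)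
Lemma dominated_FTC2 (R : realType) (f F g G : R -> R) (a b : R) : a < b ->
  (forall x, a < x < b -> `|f x| <= g x) ->
  (forall x, a < x < b -> is_derive x 1 F (f x)) ->
  (forall x, a < x < b -> is_derive x 1 G (g x)) ->
  (forall x, a < x < b -> {for x, continuous f}) ->
  (forall x, a < x < b -> {for x, continuous g}) ->
  F x @[x --> a^'+] --> F a -> F x @[x --> b^'-] --> F b ->
  G x @[x --> a^'+] --> G a -> G x @[x --> b^'-] --> G b ->
  (@lebesgue_measure R).-integrable `[a, b] (EFin \o f) /\
  \int[@lebesgue_measure R]_(x in `[a, b]) f x = F b - F a.
Proof.
move=> ab fg dF dG cf cg Fa Fb Ga Gb.
have g0 x : a < x < b -> 0 <= g x.
  by move=> /fg; apply: le_trans.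
have fDg0 x : a < x < b -> 0 <= f x + g x.
  by move=> /fg; rewrite ler_norml => /andP[? _]; lra.
have mf : measurable_fun `]a, b[%classic f.
  by apply: open_continuous_measurable_fun => // x; rewrite inE/= in_itv/= => /cf.
have mg : measurable_fun `]a, b[%classic g.
  by apply: open_continuous_measurable_fun => // x; rewrite inE/= in_itv/= => /cg.
have cfg x : a < x < b -> {for x, continuous (f + g)}.
  by move=> xab; apply: continuousD; [exact: cf|exact: cg].
have dFG x : a < x < b -> is_derive x 1 (F + G) ((f + g) x).
  by move=> xab; have := dF x xab; have := dG x xab => dg df; exact: is_deriveD.
have Ig := ge0_FTC2_oo ab g0 dG cg Ga Gb.
have Ifg := ge0_FTC2_oo ab fDg0 dFG cfg
  (cvgD Fa Ga (FF := at_right_proper_filter a))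
  (cvgD Fb Gb (FF := at_left_proper_filter b)).
have int_ge0 (h : R -> R) (r : R) : measurable_fun `]a, b[%classic h ->
    (forall x, a < x < b -> 0 <= h x) ->
    (\int[@lebesgue_measure R]_(x in `]a, b[) (h x)%:E = r%:E)%E ->
    (@lebesgue_measure R).-integrable `]a, b[ (EFin \o h).
  move=> mh h0 hr; apply/integrableP; split; first exact/measurable_EFinP.
  under eq_integral.
    move=> x; rewrite inE/= in_itv/= => /h0 hx.
    rewrite ger0_norm//; over.
  by rewrite hr ltry.
have ig := int_ge0 _ _ mg g0 Ig.
have ifg := int_ge0 _ _ (measurable_funD mf mg) fDg0 Ifg.
have ioo : (@lebesgue_measure R).-integrable `]a, b[ (EFin \o f).
  have : (@lebesgue_measure R).-integrable `]a, b[
      (fun x => (f x + g x)%R%:E - (g x)%:E)%E by apply: integrableB.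
  apply: eq_integrable => // x _ /=.
  by rewrite -EFinB addrK.
have mcc : measurable_fun `[a, b]%classic (EFin \o f).
  by apply/measurable_EFinP; exact: measurable_fun_itv_cc mf.
split.
  apply/integrableP; split=> //.
  have /integrableP[_] := ioo.
  rewrite (@integral_itv_bndoo _ a b (fun x => `|(EFin \o f) x|%E) true false)//.
  by apply: measurableT_comp => //; exact/measurable_EFinP.
rewrite /Rintegral integral_itv_bndoo; last exact/measurable_EFinP.
have -> : (\int[@lebesgue_measure R]_(x in `]a, b[) (f x)%:E =
   \int[@lebesgue_measure R]_(x in `]a, b[) (((f + g) x)%:E - (g x)%:E))%E.
  by apply: eq_integral => x _; rewrite -EFinB /= addrK.
rewrite integralB_EFin// Ifg Ig -EFinB/=.
by rewrite fctE; lra.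
Qed.

(** * Oscillating powers *)

(** Real and imaginary parts of [z * t^(c + i b)], for a complex constant [z],
    are of this form; the family is closed under differentiation. *)
Definition osc (R : realType) (c k l b t : R) : R :=
  t `^ c * (k * cos (b * ln t) + l * sin (b * ln t)).

Lemma is_derive_osc (R : realType) (c k l b t : R) : 0 < t ->
  is_derive t 1 (osc c k l b) (osc (c - 1) (c * k + b * l) (c * l - b * k) b t).
Proof.
move=> t0.
have dl : is_derive t 1 (b \*: @ln R) (b *: t^-1).
  by apply: is_deriveZ; exact: is_derive1_ln.
have dc : is_derive t 1 (k \*: (cos \o (b \*: @ln R)))
    (k *: (- sin (b * ln t) * (b *: t^-1))).
  by apply: is_deriveZ; apply: is_derive1_comp.
have ds : is_derive t 1 (l \*: (sin \o (b \*: @ln R)))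
    (l *: (cos (b * ln t) * (b *: t^-1))).
  by apply: is_deriveZ; apply: is_derive1_comp.
have dp := is_derive1_powR c t0.
refine (is_derive_eq (is_deriveM dp (is_deriveD dc ds)) _).
rewrite /osc /= /GRing.scale /=.
have -> : t `^ c = t `^ (c - 1) * t.
  rewrite -{1}(subrK 1 c) (@powRD _ t (c - 1) 1); last first.
    by apply/implyP => _; rewrite gt_eqF.
  by rewrite powRr1// ltW.
rewrite [X in X * (c * _)](_ : _ = k * cos (b * ln t) + l * sin (b * ln t))//.
by field; rewrite gt_eqF.
Qed.

Lemma continuous_osc (R : realType) (c k l b t : R) : 0 < t ->
  {for t, continuous (osc c k l b)}.
Proof.
move=> /(is_derive_osc c k l b) h.
by apply/differentiable_continuous/derivable1_diffP; exact: ex_derive.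
Qed.

Lemma normr_osc_le (R : realType) (c k l b t : R) : 0 <= t ->
  `|osc c k l b t| <= (`|k| + `|l|) * t `^ c.
Proof.
move=> t0; rewrite /osc normrM ger0_norm ?powR_ge0// mulrC.
rewrite ler_wpM2r ?powR_ge0// (le_trans (ler_normD _ _))//.
by rewrite !normrM lerD// ler_piMr// ?cos_max ?sin_max.
Qed.

Lemma osc0 (R : realType) (c k l b : R) : c != 0 -> osc c k l b 0 = 0.
Proof. by move=> c0; rewrite /osc powR0// mul0r. Qed.

Lemma cvg_osc0 (R : realType) (c k l b : R) : 0 < c ->
  osc c k l b t @[t --> 0^'+] --> osc c k l b 0.
Proof.
move=> c0; rewrite osc0 ?gt_eqF//; apply: norm_cvg0.
apply: (@squeeze_cvgr _ _ _ R (cst 0) (fun t => (`|k| + `|l|) * t `^ c)).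
- by near=> t; rewrite normr_ge0/= normr_osc_le.
- exact: cvg_cst.
- rewrite -[X in _ --> X](mulr0 (`|k| + `|l|)).
  by apply: cvgM; [exact: cvg_cst|exact: powR_cvg0].
Unshelve. all: by end_near. Qed.

(** Carries the behaviour at the singularity [0] over to the endpoint [y = x] of
    [(x - y)^a]. *)
Lemma cvg_reflect_left (R : realType) (x : R) (F : R -> R) (l : R) :
  F t @[t --> 0^'+] --> l -> F (x - y) @[y --> x^'-] --> l.
Proof.
move=> h; apply: cvg_trans h => A [e /= e0 eA].
exists e => //= y; rewrite /ball/= => xy yx; apply: eA; last by rewrite subr_gt0.
by rewrite /ball/= sub0r normrN.
Qed.

Lemma osc_dominated (R : realType) (c k l b t : R) : 0 < t ->
  `|osc c k l b t| <= osc c (`|k| + `|l|) 0 0 t.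
Proof.
move=> t0; rewrite (le_trans (normr_osc_le _ _ _ _ (ltW t0)))//.
by rewrite /osc !mul0r cos0 mulr1 addr0 mulrC.
Qed.

Lemma integral_osc (R : realType) (c k l b x : R) : 0 < c -> 0 < x ->
  let f := osc (c - 1) (c * k + b * l) (c * l - b * k) b in
  (@lebesgue_measure R).-integrable `[0, x] (EFin \o f) /\
  \int[@lebesgue_measure R]_(t in `[0, x]) f t = osc c k l b x.
Proof.
move=> c0 x0 f.
pose K : R := `|c * k + b * l| + `|c * l - b * k|.
have dG (t : R) : 0 < t < x ->
    is_derive t 1 (osc c (K / c) 0 0) (osc (c - 1) K 0 0 t).
  move=> /andP[/(is_derive_osc c (K / c) 0 0) h _].
  apply: is_derive_eq h _.
  by congr osc; field; rewrite gt_eqF.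
have [] := @dominated_FTC2 _ f (osc c k l b) (osc (c - 1) K 0 0)
  (osc c (K / c) 0 0) _ _ x0.
- by move=> t /andP[t0 _]; exact: osc_dominated.
- by move=> t /andP[t0 _]; exact: is_derive_osc.
- by move=> t /andP[t0 _]; exact: continuous_osc.
- by move=> t /andP[t0 _]; exact: continuous_osc.
- exact: cvg_osc0.
- by apply: cvg_at_left_filter; exact: continuous_osc.
- exact: cvg_osc0.
- by apply: cvg_at_left_filter; exact: continuous_osc.
by rewrite osc0 ?gt_eqF// subr0.
Qed.

Lemma integral_osc_reflect (R : realType) (c k l b x : R) : 0 < c -> 0 < x ->
  let f := osc (c - 1) (c * k + b * l) (c * l - b * k) b in
  (@lebesgue_measure R).-integrable `[0, x] (EFin \o (fun y => f (x - y))) /\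
  \int[@lebesgue_measure R]_(y in `[0, x]) f (x - y) = osc c k l b x.
Proof.
move=> c0 x0 f.
pose K : R := `|c * k + b * l| + `|c * l - b * k|.
have dS (y : R) : is_derive y 1 (fun z => x - z) (- 1).
  by apply: is_derive_eq; rewrite add0r mul1r.
have dR k' l' b' f' (y : R) : 0 < y < x ->
    osc (c - 1) (c * k' + b' * l') (c * l' - b' * k') b' =1 f' ->
    is_derive y 1 (fun z => - osc c k' l' b' (x - z)) (f' (x - y)).
  move=> /andP[_ yx] <-.
  have xy0 : 0 < x - y by rewrite subr_gt0.
  have h := is_derive_osc c k' l' b' xy0.
  refine (is_derive_eq (is_deriveN
    (@is_derive1_comp _ _ (fun z => x - z) _ _ _ h (dS y))) _).
  by rewrite mulrN1 opprK.
have cR c' k' l' b' (y : R) : y < x ->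
    {for y, continuous (fun z => osc c' k' l' b' (x - z))}.
  move=> yx; apply: (@continuous_comp _ _ _ (fun y => x - y)).
    by apply: continuousB; [exact: cvg_cst|exact: cvg_id].
  by apply: continuous_osc; rewrite subr_gt0.
have [] := @dominated_FTC2 _ (fun y => f (x - y))
  (fun y => - osc c k l b (x - y)) (fun y => osc (c - 1) K 0 0 (x - y))
  (fun y => - osc c (K / c) 0 0 (x - y)) _ _ x0.
- by move=> y /andP[_ yx]; apply: osc_dominated; rewrite subr_gt0.
- by move=> y xy; exact: dR.
- move=> y xy; apply: dR => // t.
  by congr osc; field; rewrite gt_eqF.
- by move=> t /andP[_ ?]; exact: cR.
- by move=> t /andP[_ ?]; exact: cR.
- by apply: cvgN; apply: cvg_at_right_filter; exact: cR.
- by apply: cvgN; rewrite subrr; apply: cvg_reflect_left; exact: cvg_osc0.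
- by apply: cvgN; apply: cvg_at_right_filter; exact: cR.
- by apply: cvgN; rewrite subrr; apply: cvg_reflect_left; exact: cvg_osc0.
by rewrite subrr subr0 osc0 ?gt_eqF// oppr0 sub0r opprK.
Qed.

(** * Integrals of complex-valued functions *)

(** Integrability and value are kept together because linearity of the value
    needs integrability of the summands. *)
Definition has_cint (R : realType) (D : set R) (f : R -> R[i]) (v : R[i]) :=
  cintegrable D f /\ cintegral D f = v.

Lemma eq_has_cint (R : realType) (D : set R) (f g : R -> R[i]) (v : R[i]) :
  measurable D -> (forall x, D x -> f x = g x) ->
  has_cint D f v -> has_cint D g v.
Proof.
move=> mD fg [[iRe iIm] <-]; split.
  by split; [apply: eq_integrable iRe|apply: eq_integrable iIm] => // x;
    rewrite inE => Dx /=; rewrite fg.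
by congr Complex; apply: eq_Rintegral => x; rewrite inE => Dx; rewrite fg.
Qed.

Lemma complexReM (R : realType) (z w : R[i]) :
  complex.Re (z * w) = complex.Re z * complex.Re w - complex.Im z * complex.Im w.
Proof. by case: z w => [? ?] [? ?]. Qed.

Lemma complexImM (R : realType) (z w : R[i]) :
  complex.Im (z * w) = complex.Re z * complex.Im w + complex.Im z * complex.Re w.
Proof. by case: z w => [? ?] [? ?]. Qed.

Lemma complexReD (R : realType) (z w : R[i]) :
  complex.Re (z + w) = complex.Re z + complex.Re w.
Proof. by case: z w => [? ?] [? ?]. Qed.

Lemma complexImD (R : realType) (z w : R[i]) :
  complex.Im (z + w) = complex.Im z + complex.Im w.
Proof. by case: z w => [? ?] [? ?]. Qed.

Section Rint.
Context (R : realType).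
Local Notation mu := (@lebesgue_measure R).

Lemma RintegrableD (D : set R) (f g : R -> R) : measurable D ->
  mu.-integrable D (EFin \o f) -> mu.-integrable D (EFin \o g) ->
  mu.-integrable D (EFin \o (fun x => f x + g x)).
Proof.
move=> mD fi gi.
have : mu.-integrable D (fun x => (f x)%:E + (g x)%:E)%E by apply: integrableD.
exact: eq_integrable.
Qed.

Lemma RintegrableZ (D : set R) (r : R) (f : R -> R) : measurable D ->
  mu.-integrable D (EFin \o f) -> mu.-integrable D (EFin \o (fun x => r * f x)).
Proof.
move=> mD fi.
have : mu.-integrable D (fun x => r%:E * (f x)%:E)%E by apply: integrableZl.
exact: eq_integrable.
Qed.

End Rint.

Lemma has_cintD (R : realType) (D : set R) (f g : R -> R[i]) (v w : R[i]) :
  measurable D -> has_cint D f v -> has_cint D g w ->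
  has_cint D (fun x => f x + g x) (v + w).
Proof.
move=> mD [[fR fI] <-] [[gR gI] <-].
split.
  split; [apply: eq_integrable (RintegrableD mD fR gR)|
          apply: eq_integrable (RintegrableD mD fI gI)] => // x _ /=.
    by rewrite complexReD.
  by rewrite complexImD.
apply/eqP; rewrite eq_complex complexReD complexImD /=; apply/andP; split.
  by under eq_Rintegral do rewrite complexReD; rewrite RintegralD.
by under eq_Rintegral do rewrite complexImD; rewrite RintegralD.
Qed.

Lemma has_cintZ (R : realType) (D : set R) (c : R[i]) (f : R -> R[i])
    (v : R[i]) :
  measurable D -> has_cint D f v -> has_cint D (fun x => c * f x) (c * v).
Proof.
move=> mD [[fR fI] <-].
have mul_sum (a b : R) :
    (@lebesgue_measure R).-integrable D
      (EFin \o (fun x => a * complex.Re (f x) + b * complex.Im (f x))) /\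
    \int[@lebesgue_measure R]_(x in D)
      (a * complex.Re (f x) + b * complex.Im (f x)) =
    a * \int[@lebesgue_measure R]_(x in D) complex.Re (f x) +
    b * \int[@lebesgue_measure R]_(x in D) complex.Im (f x).
  have i1 := RintegrableZ a mD fR; have i2 := RintegrableZ b mD fI.
  by split; [exact: RintegrableD|rewrite RintegralD// !RintegralZl].
have [rI rV] := mul_sum (complex.Re c) (- complex.Im c).
have [iI iV] := mul_sum (complex.Im c) (complex.Re c).
split.
  split; [apply: eq_integrable rI|apply: eq_integrable iI] => // x _ /=.
    by rewrite complexReM mulNr.
  by rewrite complexImM addrC.
apply/eqP; rewrite eq_complex complexReM complexImM /=; apply/andP; split.
  by under eq_Rintegral do rewrite complexReM -mulNr; rewrite rV mulNr.
by under eq_Rintegral do rewrite complexImM addrC; rewrite iV addrC.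
Qed.

Lemma has_cint0 (R : realType) (D : set R) : measurable D ->
  has_cint D (fun=> 0) 0.
Proof.
move=> mD; split; first by split; exact: integrable0.
by rewrite /cintegral /= !Rintegral_cst// !mul0r.
Qed.

Lemma has_cint_sum (R : realType) (D : set R) (n : nat)
    (f : 'I_n -> R -> R[i]) (v : 'I_n -> R[i]) :
  measurable D -> (forall i, has_cint D (f i) (v i)) ->
  has_cint D (fun x => \sum_(i < n) f i x) (\sum_(i < n) v i).
Proof.
move=> mD h; elim: n f v h => [|n IH] f v h.
  rewrite big_ord0; apply: eq_has_cint (has_cint0 mD) => // x _.
  by rewrite big_ord0.
rewrite big_ord_recr/=.
have hn := IH _ _ (fun i => h (widen_ord (leqnSn n) i)).
apply: eq_has_cint (has_cintD mD hn (h ord_max)) => //.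
by move=> x _; rewrite big_ord_recr.
Qed.

(** * Complex powers and the Beta integral *)

Lemma complexRe_nat (R : realType) (k : nat) : complex.Re (k%:R : R[i]) = k%:R.
Proof. by rewrite -(rmorph_nat (real_complex R)). Qed.

Lemma complexIm_nat (R : realType) (k : nat) : complex.Im (k%:R : R[i]) = 0.
Proof. by rewrite -(rmorph_nat (real_complex R)). Qed.

Lemma complexRe_half (R : realType) (z : R[i]) :
  complex.Re (z / 2) = complex.Re z / 2.
Proof.
rewrite -[in RHS](@divfK _ 2 _ z) ?pnatr_eq0//.
by rewrite [in RHS]complexReM (complexRe_nat _ 2) (complexIm_nat _ 2) mulr0
  subr0 mulfK ?pnatr_eq0.
Qed.

Lemma cpowE (R : realType) (t : R) (b : R[i]) :
  cpow t b = osc (complex.Re b) 1 0 (complex.Im b) t +i*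
             osc (complex.Re b) 0 1 (complex.Im b) t.
Proof.
apply/eqP; rewrite /cpow eq_complex complexReM complexImM /osc /=.
by rewrite !mul0r !mul1r subr0 !addr0 add0r !eqxx.
Qed.

(** [t^(b+1) / (b + 1)] is the antiderivative of [t^b]; it is put in the shape
    covered by the integrals of oscillating powers. *)
Lemma cpow_antiderivative (R : realType) (t : R) (b : R[i]) :
  let c := complex.Re b + 1 in let d := complex.Im b in
  let N := c ^+ 2 + d ^+ 2 in
  cpow t (b + 1) / (b + 1) =
  osc c (c / N) (d / N) d t +i* osc c (- d / N) (c / N) d t.
Proof.
case: b => a d /=.
apply/eqP; rewrite cpowE eq_complex complexReM complexImM /osc /= addr0.
by apply/andP; split; apply/eqP; ring.
Qed.

Lemma has_cint_cpow (R : realType) (b : R[i]) (x : R) :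
  -1 < complex.Re b -> 0 <= x ->
  has_cint `[0, x] (fun t => cpow t b) (cpow x (b + 1) / (b + 1)) /\
  has_cint `[0, x] (fun y => cpow (x - y) b) (cpow x (b + 1) / (b + 1)).
Proof.
move=> hb; rewrite cpow_antiderivative; set c := _ + 1; set d := complex.Im b.
set N := _ + _.
have c0 : 0 < c by rewrite /c -ltrBlDr sub0r.
have N0 : N != 0 by rewrite gt_eqF// ltr_wpDr ?sqr_ge0// exprn_gt0.
rewrite le_eqVlt => /predU1P[<-|x0].
  have iz (f : R -> R) : (@lebesgue_measure R).-integrable `[0, 0] (EFin \o f).
    rewrite set_itv1; apply/integrableP; split; first exact: measurable_fun_set1.
    by rewrite integral_set1.
  by rewrite !osc0 ?gt_eqF//; split; (split; [by split; exact: iz|]);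
     rewrite /cintegral set_itv1 !Rintegral_set1.
have Rek : c * (c / N) + d * (d / N) = 1 by rewrite /N; field.
have Rel : c * (d / N) - d * (c / N) = 0 by field.
have Imk : c * (- d / N) + d * (c / N) = 0 by field.
have Iml : c * (c / N) - d * (- d / N) = 1 by rewrite /N; field.
have cE : c - 1 = complex.Re b by rewrite /c addrK.
have ReE t : complex.Re (cpow t b) =
    osc (c - 1) (c * (c / N) + d * (d / N)) (c * (d / N) - d * (c / N)) d t.
  by rewrite cpowE/= Rek Rel cE.
have ImE t : complex.Im (cpow t b) =
    osc (c - 1) (c * (- d / N) + d * (c / N)) (c * (c / N) - d * (- d / N)) d t.
  by rewrite cpowE/= Imk Iml cE.
split.
  have [iR vR] := integral_osc (c / N) (d / N) d c0 x0.
  have [iI vI] := integral_osc (- d / N) (c / N) d c0 x0.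
  split.
    by split; [apply: eq_integrable iR|apply: eq_integrable iI] => // t _;
       rewrite /comp ?ReE ?ImE.
  rewrite /cintegral.
  by congr Complex; [rewrite -vR|rewrite -vI]; apply: eq_Rintegral => t _;
    rewrite ?ReE ?ImE.
have [iR vR] := integral_osc_reflect (c / N) (d / N) d c0 x0.
have [iI vI] := integral_osc_reflect (- d / N) (c / N) d c0 x0.
split.
  by split; [apply: eq_integrable iR|apply: eq_integrable iI] => // t _;
       rewrite /comp ?ReE ?ImE.
rewrite /cintegral.
by congr Complex; [rewrite -vR|rewrite -vI]; apply: eq_Rintegral => t _;
  rewrite ?ReE ?ImE.
Qed.

(** Also valid at [t = 0], where both sides vanish because the exponent on the
    right has positive real part; no exceptional null set is needed later. *)
Lemma cpow_mulr (R : realType) (t : R) (b : R[i]) :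
  0 <= t -> -1 < complex.Re b -> cpow t b * t%:C = cpow t (b + 1).
Proof.
move=> + hb; have c0 : 0 < complex.Re b + 1 by rewrite -ltrBlDr sub0r.
rewrite !cpowE complexReD complexImD [complex.Re 1]/= [complex.Im 1]/= addr0.
have Epow (t' : R) : 0 <= t' ->
    t' `^ (complex.Re b + 1) = t' `^ complex.Re b * t'.
  move=> h; rewrite -(mulr_powRB1 h c0) addrK mulrC //.
move=> t0; apply/eqP; rewrite eq_complex complexReM complexImM /= /osc.
by rewrite Epow// !mulr0 subr0 add0r; apply/andP; split; apply/eqP; ring.
Qed.

Lemma cpow_mulrX (R : realType) (t : R) (b : R[i]) (k : nat) :
  0 <= t -> -1 < complex.Re b -> cpow t b * (t ^+ k)%:C = cpow t (b + k%:R).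
Proof.
move=> t0 hb; elim: k => [|k IH]; first by rewrite expr0 mulr1 addr0.
rewrite exprSr rmorphM mulrA IH cpow_mulr//.
  by rewrite -addrA -natr1.
by rewrite complexReD complexRe_nat ltr_wpDr.
Qed.

Lemma cpow1 (R : realType) (b : R[i]) : cpow 1 b = 1.
Proof.
rewrite /cpow powR1 ln1 mulr0 cos0 sin0; exact: mulr1.
Qed.

Lemma addrn_neq0 (R : realType) (a : R[i]) (k : nat) :
  -1 < complex.Re a -> a + k.+1%:R != 0.
Proof.
move=> ha; apply/eqP => /(congr1 (@complex.Re R)).
rewrite complexReD complexRe_nat -natr1 => /eqP; rewrite gt_eqF//=.
by have := ler0n R k; move: ha; lra.
Qed.

(** [Gamma(a+1) Gamma(j+1) / Gamma(a+j+2)], the value of the Beta integral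
    [int_0^1 (1 - y)^a y^j dy]. *)
Definition beta_coef (F : fieldType) (a : F) (j : nat) : F :=
  j`!%:R / pochhammer (a + 1) j.+1.

Lemma pochhammerS (F : fieldType) (a : F) (k : nat) :
  pochhammer a k.+1 = pochhammer a k * (a + k%:R).
Proof. by rewrite /pochhammer big_ord_recr. Qed.

Lemma pochhammerSl (F : fieldType) (a : F) (k : nat) :
  pochhammer a k.+1 = a * pochhammer (a + 1) k.
Proof.
rewrite /pochhammer big_ord_recl addr0; congr (_ * _).
by apply: eq_bigr => i _; rewrite /bump /= natrD addrA.
Qed.

Lemma pochhammer0 (K : fieldType) (x : K) : pochhammer x 0 = 1.
Proof. by rewrite /pochhammer big_ord0. Qed.

Lemma pochhammer1 (K : fieldType) (x : K) : pochhammer x 1 = x.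
Proof. by rewrite /pochhammer big_ord1 addr0. Qed.

Lemma pochhammer_neq0 (R : realType) (a : R[i]) (k : nat) :
  0 < complex.Re a -> pochhammer a k != 0.
Proof.
move=> ha; apply/prodf_neq0 => i _.
have -> : a + i%:R = (a - 1) + i.+1%:R by rewrite -natr1; ring.
apply: addrn_neq0; rewrite complexReD [complex.Re (-1)]/=; lra.
Qed.

(** Induction on [j]: [(x-y)^a y^(j+1) = x (x-y)^a y^j - (x-y)^(a+1) y^j]. *)
Lemma has_cint_beta (R : realType) (a : R[i]) (x : R) (j : nat) :
  -1 < complex.Re a -> 0 <= x ->
  has_cint `[0, x] (fun y => cpow (x - y) a * (y ^+ j)%:C)
    (beta_coef a j * cpow x (a + j.+1%:R)).
Proof.
move=> ha x0; elim: j a ha => [|j IH] a ha.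
  have [_] := has_cint_cpow ha x0.
  rewrite /beta_coef /pochhammer big_ord_recl big_ord0 !addr0 mulr1 mul1r mulrC.
  by apply: eq_has_cint => // y _; rewrite expr0 mulr1.
have ha1 : -1 < complex.Re (a + 1) by rewrite complexReD ltr_wpDr/=.
have := has_cintD (measurable_itv _)
  (has_cintZ x%:C (measurable_itv _) (IH _ ha))
  (has_cintZ (-1) (measurable_itv _) (IH _ ha1)).
have -> : x%:C * (beta_coef a j * cpow x (a + j.+1%:R)) +
    -1 * (beta_coef (a + 1) j * cpow x (a + 1 + j.+1%:R)) =
    beta_coef a j.+1 * cpow x (a + j.+2%:R).
  have -> : a + 1 + j.+1%:R = a + j.+2%:R by rewrite -[in RHS]natr1; ring.
  have <- : cpow x (a + j.+1%:R) * x%:C = cpow x (a + j.+2%:R).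
    rewrite cpow_mulr//; last by rewrite complexReD complexRe_nat ltr_wpDr.
    by rewrite -addrA natr1.
  have -> : beta_coef a j.+1 = beta_coef a j - beta_coef (a + 1) j.
    rewrite /beta_coef factS natrM [pochhammer (a + 1) j.+2]pochhammerSl.
    rewrite [pochhammer (a + 1) j.+1]pochhammerSl.
    rewrite [pochhammer (a + 1 + 1) j.+1]pochhammerS.
    have h1 : a + 1 != 0 := addrn_neq0 0 ha.
    have h2 : a + j.+2%:R != 0 := addrn_neq0 j.+1 ha.
    have h3 : pochhammer (a + 1 + 1) j != 0.
      apply: pochhammer_neq0; rewrite !complexReD/=; lra.
    rewrite -natr1; move: h2; rewrite -natr1 -natr1 => h2.
    field; rewrite h1 h3 /= !andbT.
    by apply: contra h2 => /eqP h; apply/eqP; rewrite -h; ring.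
  by ring.
apply: eq_has_cint => // y /=; rewrite in_itv/= => /andP[y0 yx].
rewrite -(@cpow_mulr _ (x - y))// ?subr_ge0// exprS !rmorphM rmorphB /=.
by ring.
Qed.

(** * The double integral as a bilinear form on polynomials *)

(** The formal value of [int_0^1 x^s f(x) dx]. *)
Definition moment (F : fieldType) (s : F) (f : {poly F}) : F :=
  \sum_(i < size f) f`_i / (s + i.+1%:R).

(** The formal value of [int_0^1 int_0^x (x - y)^a f(x) g(y) dy dx]. *)
Definition bform (F : fieldType) (a : F) (f g : {poly F}) : F :=
  \sum_(j < size g) g`_j * beta_coef a j * moment (a + j.+1%:R) f.

Lemma horner_complex (R : realType) (f : {poly R}) (x : R) :
  (f.[x])%:C = \sum_(i < size f) (f`_i)%:C * (x ^+ i)%:C.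
Proof.
by rewrite horner_coef rmorph_sum; apply: eq_bigr => i _; rewrite rmorphM.
Qed.

Lemma has_cint_inner (R : realType) (a : R[i]) (f g : {poly R}) (x : R) :
  -1 < complex.Re a -> 0 <= x ->
  has_cint `[0, x] (fun y => cpow (x - y) a * (f.[x])%:C * (g.[y])%:C)
    (\sum_(j < size g) (g`_j)%:C * beta_coef a j *
       ((f.[x])%:C * cpow x (a + j.+1%:R))).
Proof.
move=> ha x0.
have := has_cint_sum (measurable_itv _) (fun j : 'I_(size g) =>
  has_cintZ ((g`_j)%:C * (f.[x])%:C) (measurable_itv _)
    (has_cint_beta j ha x0)).
rewrite (_ : \sum_(j < size g) _ =
    \sum_(j < size g) (g`_j)%:C * beta_coef a j *
      ((f.[x])%:C * cpow x (a + j.+1%:R))).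
  apply: eq_has_cint => // y _.
  rewrite (horner_complex g) mulr_sumr; apply: eq_bigr => j _.
  by ring.
by apply: eq_bigr => j _; ring.
Qed.

Lemma has_cint_moment (R : realType) (b : R[i]) (f : {poly R}) :
  -1 < complex.Re b ->
  has_cint `[0, 1] (fun x => (f.[x])%:C * cpow x b)
    (moment b (map_poly (real_complex R) f)).
Proof.
move=> hb; rewrite /moment size_map_poly.
have hbi (i : nat) : -1 < complex.Re (b + i%:R).
  by rewrite complexReD complexRe_nat ltr_wpDr.
have := has_cint_sum (measurable_itv _) (fun i : 'I_(size f) =>
  has_cintZ ((f`_i)%:C) (measurable_itv _)
    (has_cint_cpow (hbi i) ler01).1).
rewrite (_ : \sum_(i < size f) _ =
    \sum_(i < size f) (map_poly (real_complex R) f)`_i / (b + i.+1%:R)).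
  apply: eq_has_cint => // x /=; rewrite in_itv/= => /andP[x0 _].
  rewrite horner_complex mulr_suml; apply: eq_bigr => i _.
  by rewrite -cpow_mulrX//; ring.
by apply: eq_bigr => i _; rewrite cpow1 coef_map mul1r -addrA natr1.
Qed.

Lemma has_cint_outer (R : realType) (a : R[i]) (f g : {poly R}) :
  -1 < complex.Re a ->
  has_cint `[0, 1]
    (fun x => cintegral `[0, x]
       (fun y => cpow (x - y) a * (f.[x])%:C * (g.[y])%:C))
    (bform a (map_poly (real_complex R) f) (map_poly (real_complex R) g)).
Proof.
move=> ha; rewrite /bform size_map_poly.
have haj (j : nat) : -1 < complex.Re (a + j.+1%:R).
  by rewrite complexReD complexRe_nat ltr_wpDr.
have := has_cint_sum (measurable_itv _) (fun j : 'I_(size g) =>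
  has_cintZ ((g`_j)%:C * beta_coef a j) (measurable_itv _)
    (has_cint_moment f (haj j))).
rewrite (_ : \sum_(j < size g) _ = \sum_(j < size g)
    (map_poly (real_complex R) g)`_j * beta_coef a j *
      moment (a + j.+1%:R) (map_poly (real_complex R) f)).
  apply: eq_has_cint => // x /=; rewrite in_itv/= => /andP[x0 _].
  by have [_ ->] := has_cint_inner f g ha x0.
by apply: eq_bigr => j _; rewrite coef_map.
Qed.

(** * Moments and integration by parts *)

Section Moment.
Context (F : numFieldType).
Implicit Types (f g h : {poly F}) (s a c : F).

Lemma moment_widen s f n : (size f <= n)%N ->
  moment s f = \sum_(i < n) f`_i / (s + i.+1%:R).
Proof.
move=> fn; rewrite /moment (big_ord_widen n (fun i => f`_i / (s + i.+1%:R)))//.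
rewrite big_mkcond; apply: eq_bigr => i _.
by case: ltnP => // h; rewrite nth_default// mul0r.
Qed.

Lemma momentD s f g : moment s (f + g) = moment s f + moment s g.
Proof.
pose n := maxn (size f) (size g).
have [hf hg] : (size f <= n)%N /\ (size g <= n)%N by rewrite leq_maxl leq_maxr.
rewrite (moment_widen _ hf) (moment_widen _ hg).
rewrite (moment_widen _ (size_polyD f g : (_ <= n)%N)).
by rewrite -big_split; apply: eq_bigr => i _; rewrite coefD mulrDl.
Qed.

Lemma momentZ s c f : moment s (c *: f) = c * moment s f.
Proof.
rewrite (@moment_widen _ (c *: f) (size f)) ?size_scale_leq//.
by rewrite mulr_sumr; apply: eq_bigr => i _; rewrite coefZ mulrA.
Qed.

Lemma momentB s f g : moment s (f - g) = moment s f - moment s g.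
Proof. by rewrite momentD -scaleN1r momentZ mulN1r. Qed.

Lemma bform_widen a f g n : (size g <= n)%N ->
  bform a f g = \sum_(j < n) g`_j * beta_coef a j * moment (a + j.+1%:R) f.
Proof.
move=> gn; rewrite /bform (big_ord_widen n
  (fun j => g`_j * beta_coef a j * moment (a + j.+1%:R) f))//.
rewrite big_mkcond; apply: eq_bigr => i _.
by case: ltnP => // h; rewrite nth_default// !mul0r.
Qed.

Lemma bformBl a f g h : bform a (f - g) h = bform a f h - bform a g h.
Proof.
by rewrite -sumrB; apply: eq_bigr => j _; rewrite momentB mulrBr.
Qed.

Lemma bformZl a c f h : bform a (c *: f) h = c * bform a f h.
Proof.
by rewrite mulr_sumr; apply: eq_bigr => j _; rewrite momentZ mulrCA.
Qed.

Lemma bformZr a c f h : bform a h (c *: f) = c * bform a h f.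
Proof.
rewrite (@bform_widen _ _ (c *: f) (size f)) ?size_scale_leq//.
by rewrite mulr_sumr; apply: eq_bigr => i _; rewrite coefZ !mulrA.
Qed.

Lemma bformDr a h f g : bform a h (f + g) = bform a h f + bform a h g.
Proof.
pose n := maxn (size f) (size g).
have [hf hg] : (size f <= n)%N /\ (size g <= n)%N by rewrite leq_maxl leq_maxr.
rewrite (bform_widen _ _ hf) (bform_widen _ _ hg).
rewrite (bform_widen _ _ (size_polyD f g : (_ <= n)%N)).
by rewrite -big_split; apply: eq_bigr => i _; rewrite coefD !mulrDl.
Qed.

Lemma bformBr a h f g : bform a h (f - g) = bform a h f - bform a h g.
Proof. by rewrite bformDr -scaleN1r bformZr mulN1r. Qed.

Lemma leq_size_deriv f : (size f^`() <= size f)%N.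
Proof.
by have [->|/lt_size_deriv/ltnW//] := eqVneq f 0; rewrite deriv0.
Qed.

(** Integration by parts in [int_0^1 x^(s+1) f'(x) dx]. *)
Lemma moment_deriv s f : (forall k : nat, s + k.+1%:R != 0) ->
  moment (s + 1) f^`() = f.[1] - (s + 1) * moment s f.
Proof.
move=> hs; rewrite (@moment_widen _ f^`() (size f)) ?leq_size_deriv//.
rewrite (@moment_widen _ f (size f).+1) ?leqnSn//.
rewrite (@horner_coef_wide _ (size f).+1) ?leqnSn// mulr_sumr -sumrB.
rewrite big_ord_recl /= expr1n mulr1 mulrCA divff ?(hs 0)// mulr1 subrr add0r.
apply: eq_bigr => i _; rewrite coef_deriv /bump /= add1n expr1n mulr1.
rewrite -[_ *+ _]mulr_natr.
have -> : s + 1 + i.+1%:R = s + i.+2%:R by rewrite -[in RHS]natr1; ring.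
have := hs i.+1; rewrite -[i.+2%:R]natr1 => h.
by field; rewrite nat1r.
Qed.

Lemma beta_coefS a j : (forall k : nat, a + k.+1%:R != 0) ->
  beta_coef a j.+1 * (a + j.+2%:R) = j.+1%:R * beta_coef a j.
Proof.
move=> ha; rewrite /beta_coef factS natrM [pochhammer _ j.+2]pochhammerS.
have h1 : pochhammer (a + 1) j.+1 != 0.
  by apply/prodf_neq0 => i _; rewrite -addrA nat1r.
have -> : a + 1 + j.+1%:R = a + j.+2%:R by rewrite -[in RHS]natr1; ring.
have := ha j.+1; rewrite -!natr1 => h2.
by field; rewrite h1 h2.
Qed.

(** The algebraic form of [(d/dx + d/dy) (x - y)^a = 0]. The two boundary terms
    of the triangle [0 <= y <= x <= 1] other than the diagonal lie on [x = 1]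
    and on [y = 0], hence the hypotheses. *)
Lemma bform_parts a f g : (forall k : nat, a + k.+1%:R != 0) ->
  f.[1] = 0 -> g`_0 = 0 -> bform a f^`() g = - bform a f g^`().
Proof.
move=> ha f1 g0; apply/eqP; rewrite -addr_eq0; apply/eqP.
rewrite (@bform_widen _ _ g (size g).+1) ?leqnSn//.
rewrite (@bform_widen _ _ g^`() (size g)) ?leq_size_deriv//.
rewrite big_ord_recl g0 !mul0r add0r -big_split big1// => j _ /=.
rewrite /bump /= add1n.
have -> : a + j.+2%:R = a + j.+1%:R + 1 by rewrite -natr1; ring.
rewrite moment_deriv ?f1; last by move=> k; rewrite -addrA -natrD addnS.
rewrite coef_deriv -[g`_j.+1 *+ _]mulr_natr.
have := beta_coefS j ha.
rewrite -[j.+2%:R]natr1 => h.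
by rewrite sub0r -(mulrA _ _ (beta_coef a j)) -h; ring.
Qed.

End Moment.

(** * Polynomials whose first moments vanish *)

Section MomentZeros.
Context (F : numFieldType).
Implicit Types (f : {poly F}) (s : F).

Let node (j : nat) : F := - j.+1%:R.

(** Clearing the denominators [s + j + 1], for [j <= m], in the moment of a
    polynomial of degree at most [m] leaves a polynomial in [s], expanded here on
    the Lagrange basis of the nodes [- (j + 1)]. *)
Definition moment_basis (m : nat) (i : 'I_m.+1) : {poly F} :=
  \prod_(j < m.+1 | j != i) ('X - (node j)%:P).

Definition moment_numerator (m : nat) f : {poly F} :=
  \sum_(i < m.+1) f`_i *: moment_basis i.

Lemma size_moment_basis m (i : 'I_m.+1) : size (moment_basis i) = m.+1.
Proof.
rewrite /moment_basis -big_filter size_prod_XsubC; congr _.+1.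
by rewrite -[size _]cardE cardC1 card_ord.
Qed.

Lemma moment_numeratorE m f s : (size f <= m.+1)%N ->
  (forall k : nat, s + k.+1%:R != 0) ->
  (moment_numerator m f).[s] = moment s f * \prod_(j < m.+1) (s + j.+1%:R).
Proof.
move=> fm hs; rewrite (moment_widen _ fm) horner_sum mulr_suml.
apply: eq_bigr => i _; rewrite hornerZ horner_prod [in RHS](bigD1 i)//=.
rewrite -[RHS]mulrA mulKf//; congr (_ * _).
by apply: eq_bigr => j _; rewrite hornerXsubC opprK.
Qed.

(** The residue of the moment at its pole [- (k + 1)] is the coefficient
    [f_k]. *)
Lemma moment_numerator_node m f (k : 'I_m.+1) :
  (moment_numerator m f).[node k] =
  f`_k * \prod_(j < m.+1 | j != k) (j%:R - k%:R).
Proof.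
rewrite horner_sum (bigD1 k)//= [X in _ + X]big1 => [|i ik].
  rewrite addr0 hornerZ horner_prod; congr (_ * _); apply: eq_bigr => j _.
  by rewrite hornerXsubC /node -!natr1; ring.
by rewrite hornerZ horner_prod (bigD1 k) 1?eq_sym//= hornerXsubC subrr mul0r mulr0.
Qed.

(** Both sides have degree at most [m], the same coefficient of degree [m],
    namely the sum [f(1)] of the coefficients, and they agree at
    [0, ..., m - 1]. *)
Lemma moment_numerator_factor m f : (size f <= m.+1)%N ->
  (forall k, (k < m)%N -> moment k%:R f = 0) ->
  moment_numerator m f = f.[1] *: \prod_(j < m) ('X - (j%:R)%:P).
Proof.
move=> fm f0; apply/eqP; rewrite -subr_eq0; apply/eqP.
set p := _ - _.
have coef_monic (q : {poly F}) : q \is monic -> size q = m.+1 -> q`_m = 1.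
  by move=> /monicP; rewrite /lead_coef => <- ->.
have size_p : (size p <= m)%N.
  have sizeP : size (\prod_(j < m) ('X - (j%:R)%:P) : {poly F}) = m.+1.
    by rewrite size_prod_XsubC [index_enum _]unlock -enumT size_enum_ord.
  apply/leq_sizeP => j; rewrite leq_eqVlt => /predU1P[<-|mj].
    rewrite /p coefB coefZ (coef_monic (\prod_(j < m) _)) ?monic_prod_XsubC//.
    rewrite mulr1 coef_sum.
    rewrite (horner_coef_wide _ fm); apply/eqP; rewrite subr_eq0; apply/eqP.
    apply: eq_bigr => i _; rewrite expr1n mulr1 coefZ coef_monic ?mulr1//.
      exact: monic_prod_XsubC.
    exact: size_moment_basis.
  rewrite /p coefB coefZ coef_sum big1 => [|i _].
    by rewrite sub0r nth_default ?sizeP// mulr0 oppr0.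
  have -> : (f`_i *: moment_basis i)`_j = f`_i * (moment_basis i)`_j.
    exact: coefZ.
  by rewrite [X in _ * X]nth_default ?mulr0// size_moment_basis.
apply: (@roots_geq_poly_eq0 _ p [seq k%:R | k <- iota 0 m]).
- apply/allP => x /mapP[k]; rewrite mem_iota => /andP[_ km] ->.
  rewrite /root /p hornerD hornerN hornerZ moment_numeratorE//.
  rewrite f0// mul0r sub0r horner_prod (bigD1 (Ordinal km))//=.
  by rewrite hornerXsubC subrr mul0r mulr0 oppr0.
- rewrite map_inj_uniq ?iota_uniq//.
  by move=> x y /eqP; rewrite eqr_nat => /eqP.
- by rewrite size_map size_iota.
Qed.

Lemma moment_closed_form m f s : (size f <= m.+1)%N ->
  (forall k, (k < m)%N -> moment k%:R f = 0) ->
  (forall k : nat, s + k.+1%:R != 0) ->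
  moment s f = f.[1] * (\prod_(j < m) (s - j%:R) / \prod_(j < m.+1) (s + j.+1%:R)).
Proof.
move=> fm f0 hs; have := moment_numeratorE fm hs.
rewrite moment_numerator_factor// hornerZ horner_prod.
under eq_bigr do rewrite hornerXsubC.
by move=> h; rewrite mulrA h mulfK//; apply/prodf_neq0 => j _.
Qed.

Lemma prod_node_diff (k r : nat) :
  \prod_(j < (k + r).+1 | j != k :> nat) (j%:R - k%:R : F) =
  (-1) ^+ k * k`!%:R * r`!%:R.
Proof.
(* Only the factors with [j > k] change with [r]; they contribute [r!]. *)
rewrite big_mkcond; elim: r => [|r IH]; last first.
  rewrite addnS big_ord_recr /= IH factS natrM gtn_eqF ?ltnS ?leq_addr//=.
  by rewrite -addnS natrD; ring.
rewrite addn0 big_ord_recr /= eqxx !mulr1.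
rewrite (eq_bigr (fun j : 'I_k => - (rev_ord j).+1%:R)); last first.
  move=> j _ /=; rewrite ltn_eqF//= -subSn// subSS natrB ?opprB//.
  exact: ltnW.
rewrite (reindex_inj rev_ord_inj) prodrN card_ord; congr (_ * _).
rewrite (eq_bigr (fun j : 'I_k => j.+1%:R)) => [|j _]; last first.
  by rewrite rev_ordK.
elim: k => [|k IH]; first by rewrite big_ord0.
by rewrite big_ord_recr /= IH factS natrM mulrC.
Qed.

(** The factor [k!] completes the product to a full factorial. *)
Lemma prod_node_shift (m k : nat) :
  \prod_(j < m) (node k - j%:R) * k`!%:R = (-1) ^+ m * (m + k)`!%:R.
Proof.
elim: m => [|m IH]; first by rewrite big_ord0 mul1r.
rewrite big_ord_recr /= mulrAC IH addSn factS natrM exprS /node.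
by rewrite -natr1 -[(m + k).+1%:R]natr1 natrD; ring.
Qed.

(** The hypergeometric form [(-1)^m 2F1(-m, m + 1; 1; x)] of the shifted Legendre
    polynomial. Unlike a quotient of factorials it needs no case distinction for
    [k > m], where a factor of the product vanishes. *)
Definition legendre_coef (m k : nat) : F :=
  (-1) ^+ m * \prod_(i < k) ((i%:R - m%:R) * (m.+1%:R + i%:R)) / k`!%:R ^+ 2.

Lemma prod_legendre_fact (r k : nat) :
  \prod_(i < k) ((i%:R - (k + r)%:R) * ((k + r).+1%:R + i%:R)) * r`!%:R =
  (-1) ^+ k * (k + r + k)`!%:R :> F.
Proof.
suff h n : forall j, (j <= n)%N ->
    \prod_(i < j) ((i%:R - n%:R) * (n.+1%:R + i%:R)) * (n - j)`!%:R =
    (-1) ^+ j * (n + j)`!%:R :> F.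
  by have := h (k + r)%N k (leq_addr _ _); rewrite addKn.
elim=> [_|j IH jn]; first by rewrite big_ord0 subn0 addn0.
rewrite big_ord_recr /= exprS addnS factS natrM.
have := IH (ltnW jn).
have -> : (n - j = (n - j.+1).+1)%N by rewrite subnSK.
rewrite factS natrM subnSK// natrB ?(ltnW jn)// => E.
transitivity (- (n + j).+1%:R * ((-1) ^+ j * (n + j)`!%:R) : F); last by ring.
by rewrite -E -!natr1 natrD; ring.
Qed.

(** Evaluating the factored numerator at the node [- (k + 1)] isolates
    [f_k]. *)
Lemma legendre_coefP m f : (size f <= m.+1)%N -> f.[1] = 1 ->
  (forall k, (k < m)%N -> moment k%:R f = 0) ->
  forall k, f`_k = legendre_coef m k.
Proof.
move=> fm f1 f0 k; rewrite /legendre_coef; have [km|mk] := leqP k m; last first.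
  rewrite nth_default ?(leq_trans fm)// (bigD1 (Ordinal mk))//=.
  by rewrite subrr !mul0r mulr0 mul0r.
have km1 : (k < m.+1)%N by [].
have := moment_numerator_node f (Ordinal km1).
rewrite moment_numerator_factor// f1 scale1r horner_prod.
under eq_bigr do rewrite hornerXsubC.
move=> /(congr1 (fun z => z * k`!%:R)); rewrite prod_node_shift /=.
rewrite (eq_bigl (fun j : 'I_m.+1 => j != k :> nat))//.
have [r ->] : exists r, m = (k + r)%N by exists (m - k)%N; rewrite subnKC.
rewrite prod_node_diff => h.
have := prod_legendre_fact r k.
set A := \prod_(i < k) _ => hA.
have k0 : k`!%:R != 0 :> F by rewrite pnatr_eq0 -lt0n fact_gt0.
have r0 : r`!%:R != 0 :> F by rewrite pnatr_eq0 -lt0n fact_gt0.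
have s0 : (-1) ^+ k != 0 :> F by rewrite signr_eq0.
apply: (mulIf (mulf_neq0 s0 (mulf_neq0 r0 (mulf_neq0 k0 k0)))).
transitivity ((-1) ^+ (k + r) * (k + r + k)`!%:R : F).
  by rewrite h; ring.
transitivity ((-1) ^+ (k + r) * (-1) ^+ k * (A * r`!%:R)); last by field.
by rewrite hA mulrA -(mulrA _ (_ ^+ k) (_ ^+ k)) -expr2 sqrr_sign mulr1.
Qed.

(** The relation [P_(n+1)' - P_(n-1)' = (2n + 1) P_n], rescaled to the unit
    interval, on coefficients, with [n = m + 1]. All three products are multiples
    of the middle one. *)
Lemma legendre_coef_deriv m k :
  k.+1%:R * (legendre_coef m.+2 k.+1 - legendre_coef m k.+1) =
  2 * (2 * m.+1%:R + 1) * legendre_coef m.+1 k.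
Proof.
pose A n k : F := \prod_(i < k) ((i%:R - n%:R) * (n.+1%:R + i%:R)).
have AS n j : A n j.+1 = A n j * ((j%:R - n%:R) * (n.+1%:R + j%:R)).
  by rewrite /A big_ord_recr.
have up j : A m.+2 j.+1 = - (m%:R + 2 + j%:R) * (m%:R + 3 + j%:R) * A m.+1 j.
  elim: j => [|j IH]; first by rewrite /A big_ord1 big_ord0 /= -!natr1; ring.
  by rewrite AS IH AS -!natr1; ring.
have dn j : A m j.+1 = - (j%:R - m%:R - 1) * (j%:R - m%:R) * A m.+1 j.
  elim: j => [|j IH]; first by rewrite /A big_ord1 big_ord0 /= -!natr1; ring.
  by rewrite AS IH AS -!natr1; ring.
rewrite /legendre_coef -!/(A _ _) up dn factS natrM !exprS -!natr1.
have k0 : k`!%:R != 0 :> F by rewrite pnatr_eq0 -lt0n fact_gt0.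
have k1 : k%:R + 1 != 0 :> F by rewrite natr1 pnatr_eq0.
by field; rewrite k0 k1.
Qed.

End MomentZeros.

(** * Shifted Legendre polynomials *)

Section LegendreShifted.
Context (R : realType).
Implicit Types (f g : {poly R}).

Definition poly_primitive f : {poly R} :=
  \poly_(i < (size f).+1) (f`_i.-1 / i%:R).

Lemma deriv_primitive f : (poly_primitive f)^`() = f.
Proof.
apply/polyP => i; rewrite coef_deriv coef_poly ltnS.
case: ltnP => [_|h]; last by rewrite nth_default// mul0rn.
by rewrite -(mulr_natr (_ / _)) mulfVK// pnatr_eq0.
Qed.

Lemma Rintegral_poly f (a b : R) : a < b ->
  \int[@lebesgue_measure R]_(x in `[a, b]) f.[x] =
  (poly_primitive f).[b] - (poly_primitive f).[a].
Proof.
move=> ab; rewrite /Rintegral (@continuous_FTC2 _ _ (horner (poly_primitive f)))//.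
- by apply: continuous_subspaceT => x; exact: continuous_horner.
- have c (x : R) : {for x, continuous (horner (poly_primitive f))}.
    exact: continuous_horner.
  split.
  + by move=> x _; apply: ex_derive.
  + by apply: cvg_at_right_filter; exact: c.
  + by apply: cvg_at_left_filter; exact: c.
- by move=> x _; rewrite derive1E derive_val deriv_primitive.
Qed.

Lemma moment0_deriv f : moment 0 f^`() = f.[1] - f`_0.
Proof.
rewrite (moment_widen _ (leq_size_deriv f)) (@horner_coef_wide _ (size f).+1)//.
rewrite big_ord_recl /= expr1n mulr1 [f`_0 + _]addrC addrK; apply: eq_bigr => i _.
by rewrite coef_deriv /bump /= add1n expr1n mulr1 add0r
  -(mulr_natr _`_i.+1) mulfK// pnatr_eq0.
Qed.

(** The change of variable [x = 2 t - 1] is made on antiderivatives, where it is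
    the chain rule for polynomials. *)
Lemma moment0_shift f :
  \int[@lebesgue_measure R]_(x in `[-1, 1]) f.[x] =
  2 * moment 0 (f \Po (2%:P * 'X - 1)).
Proof.
rewrite Rintegral_poly; last by rewrite gtrN.
set L : {poly R} := _ - 1; set G := poly_primitive f.
have dL : L^`() = 2%:P.
  by rewrite /L derivB derivM !derivC derivX mul0r add0r mulr1 subr0.
have -> : f \Po L = (2^-1 *: (G \Po L))^`().
  rewrite derivZ deriv_comp deriv_primitive dL mulrC mul_polyC scalerA.
  by rewrite mulVf ?scale1r// pnatr_eq0.
rewrite moment0_deriv -horner_coef0 !hornerZ !horner_comp -mulrBr mulVKf//.
by rewrite /L !hornerE; congr (_.[_] - _.[_]); ring.
Qed.

End LegendreShifted.

Section Legendre.
Context (R : realType) (P : nat -> {poly R}) (hP : is_legendre P).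
Local Notation p := (shifted P).

Lemma size_shifted n : size (p n) = n.+1.
Proof.
have [sP _ _] := hP.
rewrite /shifted size_comp_poly2 ?sP//.
have -> : 2%:P * 'X - 1 = 2%:P * 'X + (-1)%:P :> {poly R} by rewrite polyCN.
by rewrite size_MXaddC size_polyC polyC_eq0 pnatr_eq0.
Qed.

Lemma shifted1 n : (p n).[1] = 1.
Proof.
have [_ _ P1] := hP.
by rewrite /shifted horner_comp !hornerE (_ : 2 - 1 = 1 :> R)//; ring.
Qed.

Lemma shifted_orthogonal m n : m != n -> moment 0 (p m * p n) = 0.
Proof.
have [_ oP _] := hP; move=> /oP.
under eq_Rintegral do rewrite -hornerM.
rewrite moment0_shift comp_polyM => /eqP.
by rewrite mulf_eq0 pnatr_eq0 => /eqP.
Qed.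

(** [p_0, ..., p_(m-1)] span the polynomials of degree less than [m]: leading
    terms are cancelled one at a time. *)
Lemma shifted_orthogonal_lt m (f : {poly R}) : (size f <= m)%N ->
  moment 0 (f * p m) = 0.
Proof.
suff h k : forall f : {poly R}, (k <= m)%N -> (size f <= k)%N ->
  moment 0 (f * p m) = 0 by exact: h.
elim: k => [|k IH] {}f km fk.
  move: fk; rewrite leqn0 size_poly_eq0 => /eqP ->.
  by rewrite mul0r /moment size_poly0 big_ord0.
pose c := f`_k / (p k)`_k.
have pk0 : (p k)`_k != 0.
  have -> : (p k)`_k = lead_coef (p k) by rewrite /lead_coef size_shifted.
  by rewrite lead_coef_eq0 -size_poly_eq0 size_shifted.
have -> : f = (f - c *: p k) + c *: p k by rewrite subrK.
rewrite mulrDl momentD -scalerAl momentZ shifted_orthogonal ?mulr0 ?addr0.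
  apply: IH; first exact: ltnW.
  apply/leq_sizeP => j; rewrite leq_eqVlt coefB coefZ => /predU1P[<-|kj].
    by rewrite /c divfK// subrr.
  by rewrite !nth_default ?mulr0 ?subr0 ?size_shifted// (leq_trans fk).
by rewrite ltn_eqF.
Qed.

Lemma moment_Xn (k : nat) (f : {poly R}) :
  moment 0 ('X^k * f) = moment k%:R f.
Proof.
have hs : (size ('X^k * f)%R <= k + size f)%N.
  by rewrite (leq_trans (size_polyMleq _ _))// size_polyXn.
rewrite (moment_widen _ hs) big_split_ord /= big1 ?add0r.
  apply: eq_bigr => i _; rewrite coefXnM ltnNge leq_addr /= addKn.
  by rewrite add0r -natrD addnS.
by move=> i _; rewrite coefXnM ltn_ord mul0r.
Qed.

Lemma moment_shifted m k : (k < m)%N -> moment k%:R (p m) = 0.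
Proof.
by move=> km; rewrite -moment_Xn shifted_orthogonal_lt// size_polyXn.
Qed.

Lemma coef_shifted m k : (p m)`_k = legendre_coef R m k.
Proof.
apply: legendre_coefP; rewrite ?size_shifted ?shifted1//.
exact: moment_shifted.
Qed.

Lemma deriv_shiftedB n :
  (p n.+2 - p n)^`() = (2 * (2 * n.+1%:R + 1)) *: p n.+1.
Proof.
apply/polyP => k; rewrite coef_deriv coefB coefZ !coef_shifted -(mulr_natl (_ - _)).
exact: legendre_coef_deriv.
Qed.

Lemma coef0_shiftedB n : (p n.+2 - p n)`_0 = 0.
Proof.
rewrite coefB !coef_shifted /legendre_coef !big_ord0 !exprS; ring.
Qed.

Local Notation pC n := (map_poly (real_complex R) (p n)).

Lemma moment_shiftedC m (s : R[i]) : (forall k : nat, s + k.+1%:R != 0) ->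
  moment s (pC m) = (-1) ^+ m * pochhammer (- s) m / pochhammer (s + 1) m.+1.
Proof.
move=> hs; rewrite (@moment_closed_form _ m)//.
- rewrite -(rmorph1 (real_complex R)) horner_map shifted1 rmorph1 mul1r.
  congr (_ / _).
    elim: m => [|k IH]; first by rewrite /pochhammer !big_ord0 mulr1.
    by rewrite big_ord_recr /= IH pochhammerS exprS; ring.
  by apply: eq_bigr => j _; rewrite -natr1; ring.
- by rewrite size_map_poly size_shifted.
- move=> k km; rewrite /moment size_map_poly.
  have := congr1 (real_complex R) (moment_shifted km).
  rewrite rmorph0 rmorph_sum => h; rewrite -[RHS]h.
  by apply: eq_bigr => i _; rewrite coef_map rmorphM fmorphV rmorphD !rmorph_nat.
Qed.

Section Bform.
Context (a : R[i]) (ha : -1 < complex.Re a).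
Local Notation I m n := (bform a (pC m) (pC n)).

Let ha_neq0 k : a + k.+1%:R != 0. Proof. exact: addrn_neq0. Qed.

(** Integration by parts applied to [p_(m+2) - p_m] and [p_(n+2) - p_n]. *)
Lemma bform_recurrence m n :
  (2 * m.+1%:R + 1) * (I m.+1 n.+2 - I m.+1 n) =
  - ((2 * n.+1%:R + 1) * (I m.+2 n.+1 - I m n.+1)).
Proof.
pose q k := map_poly (real_complex R) (p k.+2 - p k).
have dq k : (q k)^`() = (2 * (2 * k.+1%:R + 1)) *: (pC k.+1).
  rewrite /q deriv_map deriv_shiftedB map_polyZ; congr (_ *: _).
  by rewrite !(rmorphM, rmorphD, rmorph_nat, rmorph1).
have q1 k : (q k).[1] = 0.
  rewrite -(rmorph1 (real_complex R)) horner_map hornerD hornerN !shifted1.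
  by rewrite subrr rmorph0.
have q0 k : (q k)`_0 = 0 by rewrite coef_map /= coef0_shiftedB.
have := bform_parts ha_neq0 (q1 m) (q0 n).
rewrite !dq bformZl bformZr /q !rmorphB /= bformBl bformBr -mulrN => h.
apply: (mulfI (_ : 2 != 0)); first by rewrite pnatr_eq0.
by rewrite mulrA h; ring.
Qed.

Definition closed_form (d n : nat) : R[i] :=
  (-1) ^+ d / (a + 1) *
      ((pochhammer ((d%:R - a) / 2) n * pochhammer (- a - 1) d) /
       (pochhammer ((a + d%:R + 4) / 2) n * pochhammer (a + 2) d.+1)).

Lemma closed_form_recurrence d n :
  (2 * (n + d).+2%:R + 1) * (closed_form d n.+2 - closed_form d.+2 n) =
  - ((2 * n.+1%:R + 1) * (closed_form d.+2 n.+1 - closed_form d n.+1)).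
Proof.
rewrite /closed_form.
have -> : (d.+2%:R - a) / 2 = (d%:R - a) / 2 + 1 by rewrite -!natr1; field.
have -> : (a + d.+2%:R + 4) / 2 = (a + d%:R + 4) / 2 + 1.
  by rewrite -!natr1; field.
rewrite !(pochhammerSl (_ / 2)) !(pochhammerS (_ / 2 + 1)).
rewrite !(pochhammerS (- a - 1)) (pochhammerS _ d.+2) (pochhammerS _ d.+1).
have v0 : pochhammer ((a + d%:R + 4) / 2 + 1) n != 0.
  apply: pochhammer_neq0; rewrite complexReD complexRe_half !complexReD.
  rewrite !complexRe_nat [complex.Re 1]/=; have := ler0n R d; move: ha; lra.
have w0 : pochhammer (a + 2) d.+1 != 0.
  apply: pochhammer_neq0; rewrite complexReD (complexRe_nat R 2); move: ha; lra.
have h0 := ha_neq0 0.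
have h1 : a + d%:R + 4 != 0.
  by rewrite (_ : _ + 4 = a + d.+4%:R)//; rewrite -!natr1; ring.
have h2 : a + 2 + (d%:R + 1) != 0.
  by rewrite (_ : _ + _ = a + d.+3%:R)//; rewrite -!natr1; ring.
have h3 : a + d%:R + 4 + 2 + n%:R * 2 != 0.
  rewrite (_ : _ + _ = a + (d + n + n + 5).+1%:R)//.
  by rewrite -!natr1 !natrD; ring.
move: v0 w0; set V := pochhammer _ n; set W := pochhammer _ d.+1.
set U := pochhammer _ n; set Z := pochhammer _ d.
move=> v0 w0; rewrite !exprS -!natr1 natrD.
by field; rewrite w0 v0 h1 h0 h2 h3.
Qed.

Lemma closed_form_base0 d : I d 0 = closed_form d 0.
Proof.
have c0 : (pC 0)`_0 = 1.
  rewrite coef_map coef_shifted /legendre_coef big_ord0 fact0 expr0.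
  by rewrite !mul1r expr1n invr1.
have hs k : a + 1 + k.+1%:R != 0.
  by rewrite -addrA nat1r.
rewrite /bform size_map_poly size_shifted big_ord_recl big_ord0 addr0 /= c0.
rewrite moment_shiftedC// /closed_form /beta_coef pochhammer1 !pochhammer0 fact0.
rewrite opprD -[a + 1 + 1]addrA (_ : 1 + 1 = 2)//.
have w0 : pochhammer (a + 2) d.+1 != 0.
  apply: pochhammer_neq0; rewrite complexReD (complexRe_nat R 2); move: ha; lra.
by field; rewrite w0 (ha_neq0 0).
Qed.

Lemma closed_form_base1 d : I d.+1 1 = closed_form d 1.
Proof.
have c0 : (pC 1)`_0 = -1.
  rewrite coef_map coef_shifted /legendre_coef big_ord0 fact0 expr1.
  rewrite mulr1 expr1n invr1 mulr1; exact: rmorphN1.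
have c1 : (pC 1)`_1 = 2.
  rewrite coef_map coef_shifted /legendre_coef big_ord1 (_ : 1`! = 1%N)// expr1.
  rewrite expr1n invr1 mulr1 -(rmorph_nat (real_complex R) 2).
  by congr (real_complex R _); rewrite /=; ring.
have hs1 k : a + 1 + k.+1%:R != 0 by rewrite -addrA nat1r.
have hs2 k : a + 2 + k.+1%:R != 0.
  by rewrite -addrA -(natrD _ 2) add2n.
rewrite /bform size_map_poly size_shifted 2!big_ord_recl big_ord0 addr0 /=.
rewrite /bump /= !add1n c0 c1 !moment_shiftedC// /closed_form /beta_coef.
rewrite !pochhammer1 fact0 (_ : 1`! = 1%N)//.
have -> : - (a + 1) = - a - 1 by ring.
have -> : a + 1 + 1 = a + 2 by ring.
have E : pochhammer (- (a + 2)) d.+1 = - (a + 2) * pochhammer (- a - 1) d.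
  by rewrite pochhammerSl; congr (_ * pochhammer _ _); ring.
rewrite E pochhammerSl pochhammer1 (pochhammerS (- a - 1)).
rewrite ![pochhammer (a + 2) _.+1]pochhammerSl.
rewrite [pochhammer (a + 2 + 1) d.+2]pochhammerS.
rewrite [pochhammer (a + 2 + 1) d.+1]pochhammerS.
have w0 : pochhammer (a + 2 + 1) d != 0.
  apply: pochhammer_neq0; rewrite !complexReD /=.
  by move: ha; lra.
have h0 : a + 1 != 0 := ha_neq0 0.
have h1 : a + 2 != 0 := ha_neq0 1.
have h2 : a + 2 + 1 + d%:R != 0.
  by rewrite (_ : _ + _ = a + d.+3%:R)//; rewrite -!natr1; ring.
have h3 : a + d%:R + 4 != 0.
  by rewrite (_ : _ + 4 = a + d.+4%:R)//; rewrite -!natr1; ring.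
rewrite exprS -[d.+1%:R]natr1.
by field; rewrite w0 h0 h1 h2 h3.
Qed.

(** Two consecutive columns are carried along. The recurrence at
    [(n + d + 1, n)] expresses the entry [(n + 2 + d, n + 2)] through entries of
    the two previous columns on or below the diagonal, so the hypothesis
    [n <= m] is preserved. *)
Lemma bform_closed_form n d : I (n + d) n = closed_form d n.
Proof.
suff : (forall d, I (n + d) n = closed_form d n) /\
       (forall d, I (n.+1 + d) n.+1 = closed_form d n.+1) by case.
elim: n {d} => [|n [IH0 IH1]].
  split=> d; first exact: closed_form_base0.
  by rewrite add1n closed_form_base1.
split=> // d.
(* The factor [2 m + 1] of the unknown entry in the recurrence. *)
have h0 : 2 * (n + d).+2%:R + 1 != 0 :> R[i].
  by rewrite -natrM natr1 pnatr_eq0.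
have := bform_recurrence (n + d).+1 n.
have -> : I (n + d).+2 n = closed_form d.+2 n by rewrite -IH0 !addnS.
have -> : I (n + d).+3 n.+1 = closed_form d.+2 n.+1 by rewrite -IH1 !addSn !addnS.
have -> : I (n + d).+1 n.+1 = closed_form d n.+1 by rewrite -IH1 addSn.
rewrite -closed_form_recurrence => /(mulfI h0) /addIr.
by rewrite !addSn.
Qed.

End Bform.
End Legendre.

Theorem theorem3 (R : realType) (P : nat -> {poly R}) (hP : is_legendre P)
    (m n : nat) (hnm : (n <= m)%N) (alpha : R[i])
    (halpha : -1 < complex.Re alpha) :
  let d := (m - n)%N in
  let p := shifted P in
  let integrand := fun x y : R =>
    cpow (x - y) alpha * ((p m).[x])%:C * ((p n).[y])%:C in
  let inner := fun x : R => cintegral `[0, x] (integrand x) in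
  [/\ forall x : R, 0 <= x <= 1 -> cintegrable `[0, x] (integrand x),
      cintegrable `[0, 1] inner
    & cintegral `[0, 1] inner =
      (-1) ^+ d / (alpha + 1) *
      ((pochhammer ((d%:R - alpha) / 2) n * pochhammer (- alpha - 1) d) /
       (pochhammer ((alpha + d%:R + 4) / 2) n * pochhammer (alpha + 2) d.+1))].
Proof.
move=> d p integrand inner.
have [innerI innerE] := has_cint_outer (p m) (p n) halpha.
split=> [x /andP[x0 _]||].
  by have [] := has_cint_inner (p m) (p n) halpha x0.
  exact: innerI.
have := bform_closed_form hP halpha n d.
by rewrite subnKC// /closed_form => <-.
Qed.
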